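(* Let $(M,\boldsymbol g)$ be a maximally symmetric space of dimension $n$ with curvature constant $\lambda\neq0$, i.e. $R_{abcd}=\lambda(g_{ac}g_{bd}-g_{ad}g_{bc})$. Let $p\ge 2$ and let $\boldsymbol{\mathcal A}$ be a Killing-Yano tensor of order $p$ on $M$. Then its covariant derivative $\mathcal H_{b_0b_1\cdots b_p}=\nabla_{b_0}\mathcal A_{b_1\cdots b_p}$ is a closed conformal Killing-Yano tensor of order $p+1$. More precisely, $$\nabla_a\mathcal H_{b_0b_1\cdots b_p}=2g_{a[b_0}J_{b_1\cdots b_p]},\qquad J_{b_1\cdots b_p}=-\frac{\lambda}{2}(p+1)\,\mathcal A_{b_1\cdots b_p}.$$
   Context: The metric has arbitrary signature, $\nabla$ is its Levi-Civita connection, and square brackets denote normalized (weight one) antisymmetrization. A maximally symmetric space of dimension $n$ is one admitting $\frac12n(n+1)$ independent Killing vector fields; its Riemann tensor has the form $R_{abcd}=\lambda(g_{ac}g_{bd}-g_{ad}g_{bc})$ with $\lambda$ a constant. The sign convention is $(\nabla_a\nabla_b-\nabla_b\nabla_a)V_c=R_{abc}{}^{f}V_f$. A Killing-Yano tensor of order $p$ is a totally skew-symmetric tensor $\boldsymbol A$ of rank $p$ with $\nabla_aA_{b_1b_2\cdots b_p}+\nabla_{b_1}A_{ab_2\cdots b_p}=0$. A closed conformal Killing-Yano tensor of order $q$ is a totally skew-symmetric tensor $\boldsymbol H$ of rank $q$ for which there is a skew-symmetric tensor $\boldsymbol h$ of rank $q-1$ with $\nabla_aH_{b_1b_2\cdots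 b_q}=2g_{a[b_1}h_{b_2\cdots b_q]}$. *)

(* Defs.v *)
(* Pseudo-Riemannian geometry in index notation: a tensor field is given by its
   components in every chart of a smooth atlas, the components being related on
   overlaps by the usual transformation law.  Index strings b_1 ... b_k are
   k-tuples over 'I_n. *)
From HB Require Import structures.
From mathcomp Require Import all_boot all_order all_fingroup all_algebra.
From mathcomp Require Import all_classical all_reals all_analysis.

Set Implicit Arguments.
Unset Strict Implicit.
Unset Printing Implicit Defensive.

Import Order.TTheory GRing.Theory Num.Theory.
Import numFieldNormedType.Exports.

Local Open Scope classical_set_scope.
Local Open Scope ring_scope.

Section LocalCalculus.
Variables (R : realType) (n : nat).

Definition pd (i : 'I_n) (f : 'rV[R]_n -> R) (x : 'rV[R]_n) : R :=
  'D_(delta_mx 0 i) f x.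

Fixpoint Ck (k : nat) (U : set 'rV[R]_n) (f : 'rV[R]_n -> R) : Prop :=
  (forall x, U x -> {for x, continuous f}) /\
  if k is k'.+1 then
    forall i : 'I_n, (forall x, U x -> derivable f x (delta_mx 0 i)) /\
                     Ck k' U (pd i f)
  else True.

(* Intended for open U, where the values of f outside U are irrelevant. *)
Definition smooth_on (U : set 'rV[R]_n) (f : 'rV[R]_n -> R) : Prop :=
  forall k, Ck k U f.

(* Components of a covariant tensor field of rank k in one chart. *)
Definition lfield (k : nat) := 'rV[R]_n -> k.-tuple 'I_n -> R.

Definition tset (k : nat) (b : k.-tuple 'I_n) (i : 'I_k) (d : 'I_n) :
  k.-tuple 'I_n := [tuple if j == i then d else tnth b j | j < k].

Definition tpermute (k : nat) (s : 'S_k) (b : k.-tuple 'I_n) :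
  k.-tuple 'I_n := [tuple tnth b (s j) | j < k].

(* F_[b_1 ... b_k], normalized to weight one *)
Definition antisym (k : nat) (F : k.-tuple 'I_n -> R) (b : k.-tuple 'I_n) : R :=
  (k`!%:R)^-1 * \sum_(s : 'S_k) (-1) ^+ s * F (tpermute s b).

Definition gram (g : lfield 2) (x : 'rV[R]_n) : 'M[R]_n :=
  \matrix_(a, b) g x [tuple a; b].

(* Christoffel symbol Gamma^d_ab of the Levi-Civita connection *)
Definition christoffel (g : lfield 2) (d a b : 'I_n) (x : 'rV[R]_n) : R :=
  2^-1 * \sum_(e < n) invmx (gram g x) d e *
    (pd a (g^~ [tuple e; b]) x + pd b (g^~ [tuple a; e]) x
     - pd e (g^~ [tuple a; b]) x).

(* The differentiation index comes first: for t = a b_1 ... b_k the value is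
   nabla_a T_(b_1 ... b_k). *)
Definition covd (g : lfield 2) (k : nat) (T : lfield k) : lfield k.+1 :=
  fun x t =>
    let a := thead t in
    let b : k.-tuple 'I_n := [tuple of behead t] in
    pd a (T^~ b) x
    - \sum_(i < k) \sum_(d < n) christoffel g d a (tnth b i) x * T x (tset b i d).

(* The coordinate covector field dx^f *)
Definition dcoord (f : 'I_n) : lfield 1 := fun _ t => (thead t == f)%:R.

(* R_abc^f, read off from
     (nabla_a nabla_b - nabla_b nabla_a) V_c = R_abc^f V_f
   at V = dx^f. *)
Definition riemann_up (g : lfield 2) (a b c f : 'I_n) (x : 'rV[R]_n) : R :=
  covd g (covd g (dcoord f)) x [tuple a; b; c]
  - covd g (covd g (dcoord f)) x [tuple b; a; c].

Definition riemann (g : lfield 2) (a b c d : 'I_n) (x : 'rV[R]_n) : R :=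
  \sum_(f < n) riemann_up g a b c f x * g x [tuple f; d].

End LocalCalculus.

(* Charts are indexed by an arbitrary type; outside [mdom c] and its image the
   maps [mmap c] and [minv c] take irrelevant values. *)
Record manifold (R : realType) (n : nat) := Manifold {
  mcarrier :> topologicalType;
  mchart : Type;
  mdom : mchart -> set mcarrier;
  mmap : mchart -> mcarrier -> 'rV[R]_n;
  minv : mchart -> 'rV[R]_n -> mcarrier;
  m_hausdorff : hausdorff_space mcarrier;
  m_second_countable : @second_countable mcarrier;
  m_cover : forall m, exists c, mdom c m;
  m_dom_open : forall c, open (mdom c);
  m_img_open : forall c, open (mmap c @` mdom c);
  m_mapK : forall c m, mdom c m -> minv c (mmap c m) = m;
  m_map_cont : forall c m, mdom c m -> {for m, continuous (mmap c)};
  m_inv_cont : forall c m, mdom c m -> {for mmap c m, continuous (minv c)};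
  m_transition : forall c c' (i : 'I_n),
    smooth_on (mmap c @` (mdom c `&` mdom c'))
              (fun x => mmap c' (minv c x) 0 i)
}.

Section Tensors.
Variables (R : realType) (n : nat) (M : manifold R n).

Definition mimg (c : mchart M) : set 'rV[R]_n := mmap c @` mdom c.

(* d x'^j / d x^i for the coordinates x of c and x' of c' *)
Definition jac (c c' : mchart M) (j i : 'I_n) (x : 'rV[R]_n) : R :=
  pd i (fun y => mmap c' (minv c y) 0 j) x.

Definition tfield (k : nat) := mchart M -> lfield R n k.

Definition is_tensor (k : nat) (T : tfield k) : Prop :=
  (forall c b, smooth_on (mimg c) (fun x => T c x b)) /\
  (forall c c' m, mdom c m -> mdom c' m -> forall b : k.-tuple 'I_n,
     T c (mmap c m) b =
     \sum_(d : k.-tuple 'I_n)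
        (\prod_(i < k) jac c c' (tnth d i) (tnth b i) (mmap c m))
        * T c' (mmap c' m) d).

Definition skew (k : nat) (T : tfield k) : Prop :=
  forall c x, mimg c x -> forall (s : 'S_k) (b : k.-tuple 'I_n),
    T c x (tpermute s b) = (-1) ^+ s * T c x b.

Definition vfield := mchart M -> 'rV[R]_n -> 'I_n -> R.

Definition is_vector_field (X : vfield) : Prop :=
  (forall c i, smooth_on (mimg c) (fun x => X c x i)) /\
  (forall c c' m, mdom c m -> mdom c' m -> forall j,
     X c' (mmap c' m) j = \sum_(i < n) jac c c' j i (mmap c m) * X c (mmap c m) i).

(* No condition on the signature. *)
Definition is_metric (g : tfield 2) : Prop :=
  [/\ is_tensor g,
      forall c x, mimg c x -> forall a b, g c x [tuple a; b] = g c x [tuple b; a]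
    & forall c x, mimg c x -> gram (g c) x \in unitmx].

Definition nabla (g : tfield 2) (k : nat) (T : tfield k) : tfield k.+1 :=
  fun c => covd (g c) (T c).

Definition lower (g : tfield 2) (X : vfield) : tfield 1 :=
  fun c x t => \sum_(j < n) g c x [tuple thead t; j] * X c x j.

Definition killing_vector (g : tfield 2) (X : vfield) : Prop :=
  is_vector_field X /\
  forall c x, mimg c x -> forall a b,
    nabla g (lower g X) c x [tuple a; b] + nabla g (lower g X) c x [tuple b; a] = 0.

(* Linear independence is over the constants. *)
Definition maximally_symmetric (g : tfield 2) : Prop :=
  exists K : 'I_((n * n.+1)./2) -> vfield,
    (forall r, killing_vector g (K r)) /\
    (forall k : 'I_((n * n.+1)./2) -> R,
       (forall c x, mimg c x -> forall i, \sum_r k r * K r c x i = 0) ->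
       forall r, k r = 0).

Definition constant_curvature (g : tfield 2) (lambda : R) : Prop :=
  forall ch x, mimg ch x -> forall a b c d,
    riemann (g ch) a b c d x =
    lambda * (g ch x [tuple a; c] * g ch x [tuple b; d]
              - g ch x [tuple a; d] * g ch x [tuple b; c]).

(* The condition on i makes it the position of the first index b_1 of A. *)
Definition killing_yano (g : tfield 2) (p : nat) (A : tfield p) : Prop :=
  [/\ is_tensor A, skew A
    & forall c x, mimg c x ->
      forall (a : 'I_n) (b : p.-tuple 'I_n) (i : 'I_p), i = 0 :> nat ->
        nabla g A c x [tuple of a :: b]
        + nabla g A c x [tuple of tnth b i :: tset b i a] = 0].

(* nabla_a H_(b_0 ... b_q) = 2 g_(a [b_0) h_(b_1 ... b_q]) *)
Definition ccky_equation (g : tfield 2) (q : nat)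
    (H : tfield q.+1) (h : tfield q) : Prop :=
  forall c x, mimg c x -> forall (a : 'I_n) (b : q.+1.-tuple 'I_n),
    nabla g H c x [tuple of a :: b] =
    2 * antisym (fun d : q.+1.-tuple 'I_n =>
                   g c x [tuple a; thead d] * h c x [tuple of behead d]) b.

Definition closed_conformal_killing_yano (g : tfield 2) (q : nat)
    (H : tfield q.+1) : Prop :=
  [/\ is_tensor H, skew H
    & exists h : tfield q, [/\ is_tensor h, skew h & ccky_equation g H h]].

End Tensors.

(* Main.v *)
(* Write H = nabla A.  The Killing-Yano equation and the skewness of A make H
   totally skew, so H is its own antisymmetrization.  Antisymmetrizing kills the
   Christoffel terms of nabla A as well as the second derivatives of the
   transition maps, so H is the antisymmetrized partial derivative of A and
   transforms as a tensor; no transformation law for Christoffel symbols is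
   needed.

   For the second derivative, let S_(a b_0...b_p) = 2 g_(a[b_0) J_(b_1...b_p])
   and D = nabla H - S.  By the Ricci identity, in constant curvature, the part of
   nabla_a H_(b_0...b_p) that is antisymmetric in a and b_0 equals that of S.
   Hence D is symmetric in (a, b_0) and skew in (b_0,...,b_p); comparing the two
   ways of reversing (a, b_0, b_1) by adjacent transpositions gives D = -D. *)
Require Import Defs.
From HB Require Import structures.
From mathcomp Require Import all_boot all_order all_fingroup all_algebra.
From mathcomp Require Import all_classical all_reals all_analysis.
From mathcomp Require Import ring.
Import Order.TTheory GRing.Theory Num.Theory.
Import numFieldNormedType.Exports.

Set Implicit Arguments.
Unset Strict Implicit.
Unset Printing Implicit Defensive.

Local Open Scope classical_set_scope.
Local Open Scope ring_scope.

(** * Permutations of index strings and antisymmetrization *)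

Section IndexStrings.
Context {R : realType} {n : nat}.

Lemma tnth_tpermute k (s : 'S_k) (b : k.-tuple 'I_n) j :
  tnth (tpermute s b) j = tnth b (s j).
Proof. by rewrite tnth_mktuple. Qed.

Lemma tnth_tset k (b : k.-tuple 'I_n) i d j :
  tnth (tset b i d) j = if j == i then d else tnth b j.
Proof. by rewrite tnth_mktuple. Qed.

Lemma tnth_tset_id k (b : k.-tuple 'I_n) i d : tnth (tset b i d) i = d.
Proof. by rewrite tnth_tset eqxx. Qed.

Lemma tpermuteM k (s t : 'S_k) (b : k.-tuple 'I_n) :
  tpermute (s * t)%g b = tpermute s (tpermute t b).
Proof. by apply: eq_from_tnth => j; rewrite !tnth_tpermute permM. Qed.

Lemma tpermute1 k (b : k.-tuple 'I_n) : tpermute 1%g b = b.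
Proof. by apply: eq_from_tnth => j; rewrite tnth_tpermute perm1. Qed.

Lemma tset_tset k (b : k.-tuple 'I_n) i d e : tset (tset b i d) i e = tset b i e.
Proof. by apply: eq_from_tnth => j; rewrite !tnth_tset; case: eqP. Qed.

Lemma tset_tsetC k (b : k.-tuple 'I_n) i j d e : i != j ->
  tset (tset b i d) j e = tset (tset b j e) i d.
Proof.
move=> ij; apply: eq_from_tnth => l; rewrite !tnth_tset.
by case: eqP => // ->; rewrite eq_sym (negPf ij).
Qed.

Lemma tset_tpermute k (s : 'S_k) (b : k.-tuple 'I_n) i d :
  tset (tpermute s b) i d = tpermute s (tset b (s i) d).
Proof.
apply: eq_from_tnth => j; rewrite tnth_tset !tnth_tpermute tnth_tset.
by rewrite (inj_eq perm_inj).
Qed.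

Lemma tnth_cons0 k a (b : k.-tuple 'I_n) : tnth [tuple of a :: b] ord0 = a.
Proof. by []. Qed.

Lemma tnth_consS k a (b : k.-tuple 'I_n) i :
  tnth [tuple of a :: b] (lift ord0 i) = tnth b i.
Proof. by rewrite !(tnth_nth a). Qed.

Lemma behead_cons_tuple k a (b : k.-tuple 'I_n) (t : k.+1.-tuple 'I_n) :
  t = [tuple of a :: b] -> [tuple of behead t] = b.
Proof. by move=> ->; exact/val_inj. Qed.

Lemma thead_cons k a (b : k.-tuple 'I_n) :
  thead ([tuple of a :: b] : k.+1.-tuple 'I_n) = a.
Proof. by []. Qed.

Lemma cons_eqP k (t u : k.+1.-tuple 'I_n) :
  tnth t ord0 = tnth u ord0 ->
  (forall i, tnth t (lift ord0 i) = tnth u (lift ord0 i)) -> t = u.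
Proof.
move=> h0 hS; apply: eq_from_tnth => j.
by case: (unliftP ord0 j) => [i|] ->.
Qed.

Lemma tset_cons0 k (a d : 'I_n) (b : k.-tuple 'I_n) :
  tset [tuple of a :: b] ord0 d = [tuple of d :: b].
Proof.
apply: cons_eqP => [|i]; first by rewrite tnth_tset.
by rewrite tnth_tset !tnth_consS.
Qed.

Lemma tset_consS k (a d : 'I_n) (b : k.-tuple 'I_n) i :
  tset [tuple of a :: b] (lift ord0 i) d = [tuple of a :: tset b i d].
Proof.
apply: cons_eqP => [|j]; first by rewrite tnth_tset.
by rewrite tnth_tset !tnth_consS tnth_tset (inj_eq lift_inj).
Qed.

(** The right-hand side is the index pattern of the Killing-Yano equation, so that equation can be
    read as a statement about transpositions moving slot 0. *)
Lemma tpermute_swap k a (b : k.-tuple 'I_n) (i : 'I_k) :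
  tpermute (tperm ord0 (lift ord0 i)) [tuple of a :: b] =
  [tuple of tnth b i :: tset b i a].
Proof.
apply: cons_eqP; first by rewrite tnth_tpermute tpermL tnth_consS.
move=> j; rewrite tnth_tpermute tnth_consS tnth_tset.
have [->|ji] := eqVneq j i; first by rewrite tpermR.
by rewrite tpermD ?tnth_consS // (inj_eq lift_inj) eq_sym.
Qed.

Lemma tpermute_lift k a (b : k.-tuple 'I_n) (r : 'S_k) :
  tpermute (lift_perm ord0 ord0 r) [tuple of a :: b] = [tuple of a :: tpermute r b].
Proof.
apply: cons_eqP; first by rewrite tnth_tpermute lift_perm_id.
by move=> j; rewrite tnth_tpermute lift_perm_lift !tnth_consS tnth_tpermute.
Qed.

(** A permutation fixing slot 0 acts on the tail only; skewness in the tail therefore supplies the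
    hypothesis of [antisym_cons]. *)
Lemma perm_fix0 k (r : 'S_k.+1) : r ord0 = ord0 ->
  exists r', r = lift_perm ord0 ord0 r'.
Proof.
move=> r0.
have rl i : {j | r (lift ord0 i) = lift ord0 j}.
  case: (unliftP ord0 (r (lift ord0 i))) => [j ->|]; first by exists j.
  by move=> e; have /eqP := perm_inj (etrans e (esym r0)).
have inj : injective (fun i => sval (rl i)).
  move=> i j; case: (rl i) => a /= ha; case: (rl j) => c /= hc ac.
  by apply: (@lift_inj _ ord0); apply: (@perm_inj _ r); rewrite ha hc ac.
exists (perm inj); apply/permP => j.
case: (unliftP ord0 j) => [i|] ->; last by rewrite lift_perm_id.
by rewrite lift_perm_lift permE; case: (rl i).
Qed.

(** Skewness at a single point: [skew T] is convertible to [skewsym (T c x)] at every point [x] of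
    every chart image. *)
Definition skewsym k (F : k.-tuple 'I_n -> R) :=
  forall (s : 'S_k) b, F (tpermute s b) = (-1) ^+ s * F b.

Lemma eq_antisym k (F G : k.-tuple 'I_n -> R) b :
  F =1 G -> antisym F b = antisym G b.
Proof. by move=> FG; congr (_ * _); apply: eq_bigr => s _; rewrite FG. Qed.

Lemma fact_neq0 k : (k`!%:R : R) != 0.
Proof. by rewrite pnatr_eq0 -lt0n fact_gt0. Qed.

Lemma antisym_id k (F : k.-tuple 'I_n -> R) b : skewsym F -> antisym F b = F b.
Proof.
move=> hF; rewrite /antisym.
under eq_bigr do rewrite hF mulrA -expr2 sqrr_sign mul1r.
by rewrite sumr_const card_Sn -[F b *+ _]mulr_natl mulrA mulVf ?mul1r ?fact_neq0.
Qed.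

Lemma antisymZ k (a : R) (F : k.-tuple 'I_n -> R) b :
  antisym (fun t => a * F t) b = a * antisym F b.
Proof.
rewrite /antisym mulrCA; apply: (congr1 ( *%R _)).
by rewrite mulr_sumr; apply: eq_bigr => s _; rewrite mulrCA.
Qed.

Lemma antisymB k (F G : k.-tuple 'I_n -> R) b :
  antisym (fun t => F t - G t) b = antisym F b - antisym G b.
Proof.
rewrite /antisym -mulrBr -sumrB; congr (_ * _).
by apply: eq_bigr => s _; rewrite mulrBr.
Qed.

Lemma antisymD k (F G : k.-tuple 'I_n -> R) b :
  antisym (fun t => F t + G t) b = antisym F b + antisym G b.
Proof.
rewrite /antisym -mulrDr -big_split; congr (_ * _).
by apply: eq_bigr => s _; rewrite mulrDr.
Qed.

Lemma antisym_sum (I : finType) k (F : I -> k.-tuple 'I_n -> R) b :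
  antisym (fun t => \sum_i F i t) b = \sum_i antisym (F i) b.
Proof.
rewrite /antisym -[RHS]mulr_sumr; apply: (congr1 ( *%R _)); rewrite exchange_big /=.
by apply: eq_bigr => s _; rewrite mulr_sumr.
Qed.

Lemma antisym_skewsym k (F : k.-tuple 'I_n -> R) : skewsym (antisym F).
Proof.
move=> s b; rewrite /antisym mulrCA; apply: (congr1 ( *%R _)); rewrite mulr_sumr.
rewrite (reindex_inj (mulIg s^-1%g)) /=; apply: eq_bigr => t _.
rewrite -tpermuteM mulgKV odd_permM odd_permV signr_addb.
by rewrite mulrAC mulrC mulrA.
Qed.

(** Composing the summation permutation with [tperm i j] flips its sign and keeps the value of [F],
    so the sum is its own negative. This removes both the Christoffel terms and the second
    derivatives of transition maps. *)
Lemma antisym_tperm_eq0 k (F : k.-tuple 'I_n -> R) i j b : i != j ->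
  (forall t, F (tpermute (tperm i j) t) = F t) -> antisym F b = 0.
Proof.
move=> ij hF; rewrite /antisym.
set S := \sum_(s : 'S_k) _; suff : S = - S.
  by move=> /eqP; rewrite -addr_eq0 -mulr2n mulrn_eq0 => /eqP ->; rewrite mulr0.
rewrite {1}/S (reindex_inj (mulgI (tperm i j))) /= -sumrN; apply: eq_bigr => s _.
by rewrite tpermuteM hF odd_permM odd_tperm ij signr_addb expr1 !mulN1r mulNr.
Qed.

(** The transpositions [(0 i)] generate the symmetric group: [(i j) = (0 i)(0 j)(0 i)], a product of
    three of them, and every permutation is a product of transpositions. *)
Lemma skewsym_tperm k (F : k.+1.-tuple 'I_n -> R) :
  (forall i b, F (tpermute (tperm ord0 (lift ord0 i)) b) = - F b) ->
  skewsym F.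
Proof.
move=> hF.
have h0 i b : i != ord0 -> F (tpermute (tperm ord0 i) b) = - F b.
  by case: (unliftP ord0 i) => [j ->|->]; rewrite ?eqxx.
have hT i j b : i != j -> F (tpermute (tperm i j) b) = - F b.
  move=> ij; have [i0|i0] := eqVneq i ord0.
    by rewrite i0 h0 // -i0 eq_sym.
  have [->|j0] := eqVneq j ord0; first by rewrite tpermC h0.
  have -> : tperm i j = (tperm ord0 i * tperm ord0 j * tperm ord0 i)%g.
    have := tpermJ ord0 j (tperm ord0 i).
    rewrite tpermL tpermD // 1?eq_sym // => <-.
    by rewrite conjgE tpermV mulgA.
  by rewrite !tpermuteM !h0 // opprK.
move=> s; have [ts -> dts] := prod_tpermP s.
elim: ts dts => [_ b|[i j] ts IH /= /andP[ij dts] b].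
  by rewrite big_nil odd_perm1 tpermute1 mul1r.
rewrite big_cons tpermuteM hT // IH // odd_permM odd_tperm.
by rewrite /dpair /= in ij; rewrite ij signr_addb expr1 mulN1r mulNr.
Qed.

(** Antisymmetrization commutes with a linear change of coordinates, for any [W]: a permutation of
    the slots of [t] is carried over to the summation index [d], since the factors of the product
    may be reordered. *)
Lemma antisym_change k (J : 'I_n -> 'I_n -> R) (W : k.-tuple 'I_n -> R) b :
  antisym (fun t => \sum_(d : k.-tuple 'I_n)
      (\prod_(i < k) J (tnth d i) (tnth t i)) * W d) b =
  \sum_(d : k.-tuple 'I_n) (\prod_(i < k) J (tnth d i) (tnth b i)) * antisym W d.
Proof.
rewrite /antisym.
under [RHS]eq_bigr do rewrite mulrCA mulr_sumr.
rewrite -[RHS]mulr_sumr; apply: (congr1 ( *%R _)).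
rewrite [RHS]exchange_big; apply: eq_bigr => s _ /=.
rewrite mulr_sumr (reindex (tpermute s)) /=; last first.
  exists (tpermute s^-1%g) => t _; rewrite -tpermuteM ?mulgV ?mulVg tpermute1 //.
apply: eq_bigr => d _; rewrite mulrCA; congr (_ * _).
rewrite [RHS](reindex_inj (@perm_inj _ s)).
by apply: eq_bigr => i _; rewrite !tnth_tpermute.
Qed.

(** When [F] is already skew in its last [k] slots, a term depends only on [s ord0], that is, on a
    coset of the stabilizer of slot 0. Each of the [k.+1] cosets has [k]! elements, which leaves the
    factor [k.+1] after normalization. *)
Lemma antisym_cons k (F : k.+1.-tuple 'I_n -> R) b :
  (forall r : 'S_k.+1, r ord0 = ord0 ->
    forall t, F (tpermute r t) = (-1) ^+ r * F t) ->
  k.+1%:R * antisym F b =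
  F b - \sum_(i < k) F (tpermute (tperm ord0 (lift ord0 i)) b).
Proof.
move=> hF.
(* The common value on the coset of [tperm ord0 j]; this permutation is odd except for [j = ord0],
   where it is the identity. *)
pose G (j : 'I_k.+1) := (-1) ^+ (j != ord0) * F (tpermute (tperm ord0 j) b).
have hG (s : 'S_k.+1) : (-1) ^+ s * F (tpermute s b) = G (s ord0).
  set j := s ord0; pose r := (s * tperm ord0 j)%g.
  have -> : s = (r * tperm ord0 j)%g by rewrite /r -mulgA tperm2 mulg1.
  rewrite tpermuteM hF; last by rewrite permM tpermR.
  rewrite mulrA odd_permM odd_tperm signr_addb [_ * _ * (-1) ^+ r]mulrAC.
  rewrite -expr2 sqrr_sign mul1r.
  by rewrite /G eq_sym.
(* The fibres of [s |-> s ord0] are translates of one another, so all have the same size. *)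
have cG (j : 'I_k.+1) : #|[pred s : 'S_k.+1 | s ord0 == j]| = k`!.
  have e i : #|[pred s : 'S_k.+1 | s ord0 == i]| =
             #|[pred s : 'S_k.+1 | s ord0 == ord0]|.
    rewrite -!sum1_card (reindex_inj (mulIg (tperm ord0 i))).
    apply: eq_bigl => s; rewrite !inE permM.
    by rewrite -[X in _ == X](tpermL ord0 i) (inj_eq perm_inj).
  have : (\sum_(i < k.+1) #|[pred s : 'S_k.+1 | s ord0 == i]| = k.+1`!)%N.
    rewrite -card_Sn -sum1_card (partition_big (fun s : 'S_k.+1 => s ord0) xpredT) //=.
    by apply: eq_bigr => i _; rewrite sum1_card.
  under eq_bigr do rewrite e.
  rewrite sum_nat_const card_ord factS => /eqP; rewrite eqn_pmul2l // => /eqP <-.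
  exact: e.
rewrite /antisym; under eq_bigr do rewrite hG.
rewrite (partition_big (fun s : 'S_k.+1 => s ord0) xpredT) //=.
under eq_bigr => j _.
  rewrite (eq_bigr (fun=> G j)); last by move=> s /eqP ->.
  rewrite sumr_const cG -mulr_natl; over.
rewrite -mulr_sumr factS natrM invfM !mulrA mulfV ?pnatr_eq0 // mul1r.
rewrite mulVf ?fact_neq0 // mul1r big_ord_recl /G eqxx mul1r tperm1 tpermute1.
congr (_ + _); rewrite -sumrN; apply: eq_bigr => i _.
by rewrite expr1 mulN1r.
Qed.

(** The symmetry in the two leading indices and the skewness in the next two are incompatible unless
    [D] vanishes; rank at least two makes the slot [o1] available. *)
Lemma skewsym_symmetric_eq0 k (D : 'I_n -> k.+2.-tuple 'I_n -> R) :
  (forall a, skewsym (D a)) ->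
  (forall a b, D a b = D (tnth b ord0) (tset b ord0 a)) ->
  forall a b, D a b = 0.
Proof.
move=> hD hS a b.
pose o1 : 'I_k.+2 := lift ord0 ord0.
pose sw := @tpermute n k.+2 (tperm ord0 o1).
have hsw e t : D e (sw t) = - D e t.
  by rewrite hD odd_tperm expr1 mulN1r.
suff e : D a b = - D a b.
  by apply/eqP; rewrite -[_ == _]/(false || (D a b == 0)) -(mulrn_eq0 _ 2)
     mulr2n {2}e subrr.
have tsw t j : tnth (sw t) j =
    if j == ord0 then tnth t o1 else if j == o1 then tnth t ord0 else tnth t j.
  rewrite tnth_tpermute; case: tpermP => [->|->|] //.
  by move=> /eqP/negPf -> /eqP/negPf ->.
(* With the remaining indices suppressed, the chain is [D_abc = D_bac = - D_bca = - D_cba = D_cab =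
   D_acb], and the last term is [- D_abc]. *)
rewrite -hsw hS -[LHS]opprK -hsw hS -[- _ in LHS]hsw hS.
rewrite !(tnth_tset, tsw) /=; congr (D _ _).
apply: eq_from_tnth => j; rewrite !(tnth_tset, tsw) /=.
by case: (j =P ord0) => // _; case: (j =P o1).
Qed.

End IndexStrings.

(** * Mean value theorem, symmetry of second derivatives and chain rule *)

Section Directional.
Context {R : realType} {V : normedModType R}.
Implicit Types (f : V -> R) (x v : V).

Lemma is_derive_line f x v (s : R) : derivable f (x + s *: v) v ->
  is_derive s 1 (fun t : R => f (x + t *: v)) ('D_v f (x + s *: v)).
Proof.
have E : (fun h : R => h^-1 *: (((fun t => f (x + t *: v)) \o shift s) (h *: 1)
            - f (x + s *: v))) =
         (fun h => h^-1 *: ((f \o shift (x + s *: v)) (h *: v)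
            - f (x + s *: v))).
  apply/funext => h /=.
  by rewrite [h%:A]mulr1 scalerDl addrCA.
by move=> df; split; rewrite /derivable /derive /= E.
Qed.

(** The one-variable mean value theorem for [t |-> f (x + t *: v)] on [[0, h]] or [[h, 0]]. The
    bound by absolute values covers both signs of [h]. *)
Lemma line_MVT f x v (h : R) :
  (forall s : R, `|s| <= `|h| -> derivable f (x + s *: v) v) ->
  exists2 s, `|s| <= `|h| & f (x + h *: v) - f x = h * 'D_v f (x + s *: v).
Proof.
move=> df.
have hd (s : R) : `|s| <= `|h| ->
    is_derive s 1 (fun t : R => f (x + t *: v)) ('D_v f (x + s *: v)).
  by move=> /df/is_derive_line.
have mvt (a b : R) : a <= b -> (forall s, s \in `[a, b]%R -> `|s| <= `|h|) ->
    exists2 c, `|c| <= `|h| & f (x + b *: v) - f (x + a *: v) =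
      'D_v f (x + c *: v) * (b - a).
  move=> ab hab.
  have [| |c cab e] := @MVT_segment R (fun t => f (x + t *: v))
      (fun t => 'D_v f (x + t *: v)) a b ab.
  - by move=> t tab; apply/hd/hab; apply: subset_itv_oo_cc.
  - by apply: derivable_within_continuous => t /hab/hd [].
  - by exists c; [exact: hab|].
have [h0|h0] := leP 0 h.
  have [s|c ch] := mvt 0 h h0.
    by rewrite in_itv /= => /andP[s0 sh]; rewrite !ger0_norm.
  rewrite scale0r addr0 subr0 mulrC => e; by exists c.
have [s|c ch] := mvt h 0 (ltW h0).
  by rewrite in_itv /= => /andP[s0 sh]; rewrite !ler0_norm ?(ltW h0) // lerN2.
rewrite scale0r addr0 sub0r => e; exists c => //.
by rewrite -opprB e mulrN opprK mulrC.
Qed.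

Lemma is_derive_sumr (I : finType) (F : I -> V -> R) (dF : I -> R) x v :
  (forall i, is_derive x v (F i) (dF i)) ->
  is_derive x v (fun y => \sum_i F i y) (\sum_i dF i).
Proof.
move=> h.
have -> : (fun y => \sum_i F i y) = \sum_i F i.
  by apply/funext => y; rewrite fct_sumE.
by elim/big_ind2 : _ => // [|] *; [exact: is_derive_cst|exact: is_deriveD].
Qed.

Lemma is_derive_prodr k (F : 'I_k -> V -> R) (dF : 'I_k -> R) x v :
  (forall i, is_derive x v (F i) (dF i)) ->
  is_derive x v (fun y => \prod_i F i y)
    (\sum_i dF i * \prod_(j | j != i) F j x).
Proof.
elim: k F dF => [|k IH] F dF hF.
  rewrite big_ord0.
  have -> : (fun y => \prod_i F i y) = cst 1.
    by apply/funext => y; rewrite big_ord0.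
  exact: is_derive_cst.
have -> : (fun y => \prod_i F i y) =
    (F ord0 * (fun y => \prod_i F (lift ord0 i) y))%R.
  by apply/funext => y; rewrite big_ord_recl.
have := IH (fun i => F (lift ord0 i)) (fun i => dF (lift ord0 i))
  (fun i => hF (lift ord0 i)) => {}IH.
apply: is_derive_eq (is_deriveM (hF ord0) IH) _.
rewrite big_ord_recl addrC; congr (_ + _).
  rewrite [_ *: _]mulrC; congr (_ * _).
  by rewrite [RHS]big_mkcond big_ord_recl /= mul1r.
rewrite [_ *: _]mulr_sumr; apply: eq_bigr => i _.
rewrite mulrCA; congr (_ * _).
rewrite [RHS]big_mkcond big_ord_recl /=; congr (_ * _).
by rewrite [LHS]big_mkcond; apply: eq_bigr => j _; rewrite (inj_eq lift_inj).
Qed.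

Lemma is_derive_shiftr f x v a : derivable f (x + a) v ->
  is_derive x v (fun y => f (y + a)) ('D_v f (x + a)).
Proof.
have E : (fun h : R => h^-1 *: (((fun t => f (t + a)) \o shift x) (h *: v)
            - f (x + a))) =
         (fun h => h^-1 *: ((f \o shift (x + a)) (h *: v) - f (x + a))).
  by apply/funext => h /=; rewrite addrA.
by move=> df; split; rewrite /derivable /derive /= E.
Qed.

(** The mean value theorem is applied twice: to the increment [F] of [f] along [v], in direction
    [u], and then to ['D_u f] in direction [v]. *)
Lemma second_difference f x u v (h : R) : 0 <= h ->
  (forall y, `|y - x| <= h * (`|u| + `|v|) ->
     derivable f y u /\ derivable ('D_u f) y v) ->
  exists2 y, `|y - x| <= h * (`|u| + `|v|) &
    f (x + h *: u + h *: v) - f (x + h *: u) - (f (x + h *: v) - f x) =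
    h * (h * 'D_v ('D_u f) y).
Proof.
move=> h0 hf.
have small (s t : R) : `|s| <= `|h| -> `|t| <= `|h| ->
    `|x + s *: u + t *: v - x| <= h * (`|u| + `|v|).
  rewrite (ger0_norm h0) => sh th.
  rewrite -[x + _ + _]addrA [x + _ - x]addrC addKr mulrDr.
  by rewrite (le_trans (ler_normD _ _))// !normrZ lerD// ler_wpM2r.
have h_h : `|h| <= `|h| by [].
have z_h : `|0 : R| <= `|h| by rewrite normr0.
pose F y := f (y + h *: v) - f y.
have dF (s : R) : `|s| <= `|h| -> is_derive (x + s *: u) u F
    ('D_u f (x + s *: u + h *: v) - 'D_u f (x + s *: u)).
  move=> sh; apply: is_deriveB.
    by apply: is_derive_shiftr; have [] := hf _ (small _ _ sh h_h).
  apply: derivableP.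
  by have := small _ _ sh z_h; rewrite scale0r addr0 => /hf[].
have [s sh e] : exists2 s : R, `|s| <= `|h| &
    F (x + h *: u) - F x = h * 'D_u F (x + s *: u).
  by apply: line_MVT => s /dF[].
have [t th e'] : exists2 t : R, `|t| <= `|h| &
    'D_u f (x + s *: u + h *: v) - 'D_u f (x + s *: u) =
      h * 'D_v ('D_u f) (x + s *: u + t *: v).
  apply: (@line_MVT ('D_u f) (x + s *: u) v h) => t th.
  exact: (hf _ (small _ _ sh th)).2.
exists (x + s *: u + t *: v); first exact: small.
by rewrite -e'; have [_ <-] := dF _ sh; rewrite -e.
Qed.

(** Schwarz's theorem. The second difference is symmetric in [u] and [v], so the two mixed
    derivatives agree at two points [y] and [z] near [x]; by continuity the gap [e] between their
    values at [x] would be less than [e / 2 + e / 2]. *)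
Lemma derive_comm f x u v :
  (\forall y \near x, [/\ derivable f y u, derivable f y v,
     derivable ('D_u f) y v & derivable ('D_v f) y u]) ->
  {for x, continuous ('D_v ('D_u f))} -> {for x, continuous ('D_u ('D_v f))} ->
  'D_v ('D_u f) x = 'D_u ('D_v f) x.
Proof.
move=> hd cvu cuv; apply/eqP; rewrite -subr_eq0; apply/negPn/negP => ne.
pose e := `|'D_v ('D_u f) x - 'D_u ('D_v f) x|.
have e0 : 0 < e / 2 by rewrite divr_gt0 ?normr_gt0.
have near_all : \forall y \near x,
    [/\ [/\ derivable f y u, derivable f y v,
        derivable ('D_u f) y v & derivable ('D_v f) y u],
      `|'D_v ('D_u f) x - 'D_v ('D_u f) y| < e / 2 &
      `|'D_u ('D_v f) x - 'D_u ('D_v f) y| < e / 2].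
  move/cvgrPdist_lt : cvu => /(_ _ e0) cvu.
  move/cvgrPdist_lt : cuv => /(_ _ e0) cuv.
  by apply: filterS3 hd cvu cuv => y; exact: And3.
move/nbhs_normP : near_all => [d /= d0 hball].
(* The summand 1 keeps [N] positive even if [u] and [v] both vanish; with [h = d / (2 N)] the
   intermediate points stay in the ball of radius [d]. *)
pose N := `|u| + `|v| + 1.
have N0 : 0 < N by rewrite ltr_wpDl // addr_ge0.
have NN0 : 0 < N + N by exact: addr_gt0.
pose h := d / (N + N).
have h0 : 0 < h by exact: divr_gt0.
have hN : h * (`|u| + `|v|) < d.
  rewrite -[ltRHS](@divfK _ (N + N)) ?lt0r_neq0 //.
  by rewrite -/h ltr_pM2l // ltr_wpDl ?(ltW N0)// /N ltrDl.
have inb y : `|y - x| <= h * (`|u| + `|v|) -> `|x - y| < d.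
  by move=> yh; rewrite distrC; exact: le_lt_trans yh hN.
have [y yh ey] : exists2 y, `|y - x| <= h * (`|u| + `|v|) &
    f (x + h *: u + h *: v) - f (x + h *: u) - (f (x + h *: v) - f x) =
    h * (h * 'D_v ('D_u f) y).
  by apply: second_difference (ltW h0) _ => y /inb/hball[[? _ ? _] _ _].
have [z zh ez] : exists2 y, `|y - x| <= h * (`|v| + `|u|) &
    f (x + h *: v + h *: u) - f (x + h *: v) - (f (x + h *: u) - f x) =
    h * (h * 'D_u ('D_v f) y).
  apply: second_difference (ltW h0) _ => w.
  by rewrite (addrC `|v|) => /inb/hball[[_ ? _ ?] _ _].
rewrite (addrC `|v|) in zh.
have eyz : 'D_v ('D_u f) y = 'D_u ('D_v f) z.
  apply: (mulfI (lt0r_neq0 h0)); apply: (mulfI (lt0r_neq0 h0)).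
  apply: etrans (esym ey) _; apply: etrans _ ez; rewrite (addrAC x (h *: u)).
  have swap (p q r t : R) : p - q - (r - t) = p - r - (q - t) by ring.
  exact: swap.
have [_ hy _] := hball _ (inb _ yh); have [_ _ hz] := hball _ (inb _ zh).
have : e < e.
  rewrite {1}/e -(subrKA ('D_v ('D_u f) y)) {2}eyz.
  rewrite [ltRHS]splitr; apply: le_lt_trans (ler_normD _ _) _.
  by apply: ltrD; [exact: hy|rewrite distrC; exact: hz].
by rewrite ltxx.
Qed.

End Directional.

(** * Continuous partial derivatives imply differentiability *)

Section Partial.
Context {R : realType} {n : nat}.
Implicit Types (f : 'rV[R]_n -> R) (x y w : 'rV[R]_n).

Lemma ler_rV_norm (a w : 'rV[R]_n) :
  (forall j, `|a 0 j| <= `|w 0 j|) -> `|a| <= `|w|.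
Proof.
move=> aw; rewrite [leLHS]/Num.Def.normr/= mx_normrE.
apply: bigmax_le => //= -[i j] _ /=; rewrite ord1.
apply: le_trans (aw j) _; rewrite [leRHS]/Num.Def.normr/= mx_normrE.
exact: (le_bigmax _ _ (0, j)).
Qed.

Lemma ler_coord_norm w j : `|w 0 j| <= `|w|.
Proof.
rewrite [leRHS]/Num.Def.normr/= mx_normrE.
exact: (le_bigmax _ _ (0, j)).
Qed.

(** The path from [y] to [y + w] changes one coordinate at a time, with the mean value theorem on
    each leg. Its points stay within [|w|] of [y] because the norm is the maximum norm. *)
Lemma increment_pd f y w :
  (forall z, `|z - y| <= `|w| -> forall i, derivable f z (delta_mx 0 i)) ->
  exists xi : 'I_n -> 'rV[R]_n, (forall i, `|xi i - y| <= `|w|) /\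
    f (y + w) - f y = \sum_i w 0 i * pd i f (xi i).
Proof.
move=> df.
pose part (k : nat) : 'rV[R]_n := \row_j (if (j < k)%N then w 0 j else 0).
have partS (i : 'I_n) : part i.+1 = part i + w 0 i *: delta_mx 0 i.
  apply/rowP => j; rewrite !mxE eqxx /= ltnS leq_eqVlt.
  have [->|ji] := eqVneq j i; first by rewrite ltnn eqxx mulr1 add0r.
  by rewrite [_ == _ :> nat](negPf ji) mulr0 addr0.
have small (i : 'I_n) (s : R) : `|s| <= `|w 0 i| ->
    `|y + part i + s *: delta_mx 0 i - y| <= `|w|.
  move=> sw; rewrite -[y + _ + _]addrA [y + _ - y]addrC addKr.
  apply: ler_rV_norm => j; rewrite !mxE eqxx /=.
  have [->|ji] := eqVneq j i; first by rewrite ltnn mulr1 add0r.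
  by rewrite mulr0 addr0; case: ifP => // _; rewrite normr0.
have step (i : 'I_n) : exists z, `|z - y| <= `|w| /\
    f (y + part i.+1) - f (y + part i) = w 0 i * pd i f z.
  have [s sw e] : exists2 s : R, `|s| <= `|w 0 i| &
      f (y + part i + w 0 i *: delta_mx 0 i) - f (y + part i) =
      w 0 i * 'D_(delta_mx 0 i) f (y + part i + s *: delta_mx 0 i).
    by apply: line_MVT => s sw; apply: df; apply: small.
  exists (y + part i + s *: delta_mx 0 i); split; first exact: small.
  by rewrite partS addrA e.
have [xi hxi] := choice step; exists xi; split=> [i|]; first by case: (hxi i).
under eq_bigr do rewrite -(hxi _).2.
rewrite -(big_mkord xpredT (fun i => f (y + part i.+1) - f (y + part i))).
rewrite telescope_sumr //; congr (f (_ + _) - f _).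
  by apply/rowP => j; rewrite mxE ltn_ord.
have -> : part 0%N = 0 by apply/rowP => j; rewrite !mxE.
by rewrite addr0.
Qed.

(** The remainder is a sum of [w 0 i] times the variation of the [i]-th partial derivative between
    [y] and a nearby point, hence small compared with [|w|]. *)
Lemma differentiable_pd f y :
  (\forall z \near y, forall i, derivable f z (delta_mx 0 i)) ->
  (forall i, {for y, continuous (pd i f)}) ->
  differentiable f y /\
  'd f y = (fun w => \sum_i w 0 i * pd i f y) :> ('rV[R]_n -> R).
Proof.
move=> df cf.
pose d w := \sum_i w 0 i * pd i f y.
have lin_d : linear d.
  move=> k u v; rewrite /d scaler_sumr -big_split /=; apply: eq_bigr => i _.
  by rewrite !mxE mulrDl -[_ *: (_ * _)]/(_ * (_ * _)) mulrA.
pose dM := GRing.isLinear.Build _ _ _ _ _ lin_d.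
pose dL : {linear _ -> _} := HB.pack d dM.
have cd : continuous d.
  move=> w; apply: differentiable_continuous.
  have -> : d = \sum_i (pd i f y \*: (fun w : 'rV[R]_n => w 0 i)).
    by apply/funext => v; rewrite fct_sumE; apply: eq_bigr => i _; rewrite mulrC.
  by apply: differentiable_sum => i; apply/differentiableZ/differentiable_coord.
have od (e : R) : 0 < e ->
    \forall w \near (0 : 'rV[R]_n), `|f (w + y) - (f y + d w)| <= e * `|w|.
  move=> e0.
  (* The remainder has [n] terms; dividing by [n.+1] also covers [n = 0]. *)
  pose e' := e / n.+1%:R; have e'0 : 0 < e' by rewrite divr_gt0.
  have near_pd : \forall z \near y, forall i, `|pd i f y - pd i f z| < e'.
    apply: (@filter_forall _ 'I_n (fun i z => `|pd i f y - pd i f z| < e') _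
      (nbhs_filter y)).
    by move=> i; move/cvgrPdist_lt : (cf i) => /(_ _ e'0).
  have near_all : \forall z \near y, (forall i, derivable f z (delta_mx 0 i)) /\
      (forall i, `|pd i f y - pd i f z| < e') by exact: filterI df near_pd.
  move/nbhs_normP : near_all => [r /= r0 hr].
  apply/nbhs_ballP; exists r => //= w; rewrite -ball_normE /= sub0r normrN => wr.
  have inb z : `|z - y| <= `|w| -> `|y - z| < r.
    by rewrite distrC => /le_lt_trans; apply.
  have [xi [hxi]] : exists xi : 'I_n -> 'rV[R]_n,
      (forall i, `|xi i - y| <= `|w|) /\
      f (y + w) - f y = \sum_i w 0 i * pd i f (xi i).
    by apply: increment_pd => z /inb/hr[].
  rewrite opprD addrA [w + y]addrC => ->.
  rewrite /d -sumrB; apply: le_trans (ler_norm_sum _ _ _) _.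
  apply: (@le_trans _ _ (\sum_(i < n) e' * `|w|)).
    apply: ler_sum => i _; rewrite -mulrBr normrM mulrC.
    rewrite ler_pM ?ler_coord_norm // distrC.
    by have [_ /(_ i)/ltW] := hr _ (inb _ (hxi i)).
  rewrite sumr_const card_ord -mulr_natl mulrA ler_wpM2r //.
  rewrite /e' mulrCA ger_pMr // ler_pdivrMr // mul1r ler_nat; exact: leqnSn.
have E : 'd f y = d :> ('rV[R]_n -> R).
  by apply: (@diff_unique _ _ _ f dL y cd); apply/eqaddoP => e /od.
split=> //; apply/diff_locallyP; rewrite E; split => //.
by apply/eqaddoP => e /od.
Qed.

End Partial.

Lemma derive1_line (R : realType) (V W : normedModType R) (F : V -> W) x v :
  'D_(1 : R) (fun h : R => F (h *: v + x)) 0 = 'D_v F x.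
Proof.
rewrite /derive.
have -> // : (fun h : R => h^-1 *:
      (((fun h : R => F (h *: v + x)) \o shift 0) (h *: 1) - F (0 *: v + x))) =
    (fun h => h^-1 *: ((F \o shift x) (h *: v) - F x)).
by apply/funext => h /=; rewrite addr0 scale0r add0r [h%:A]mulr1.
Qed.

(** Chain rule for a map [phi] that is only derivable along [v]. On the line through [x] it becomes
    the curve [c] of one real variable, where derivable and differentiable coincide, and the chain
    rule for differentials applies to [f \o c]. *)
Lemma is_derive_comp (R : realType) (V : normedModType R) (m : nat)
    (f : 'rV[R]_m -> R) (phi : V -> 'rV[R]_m) x v (dphi : 'I_m -> R) :
  (forall j, is_derive x v (fun y => phi y 0 j) (dphi j)) ->
  (\forall z \near phi x, forall j, derivable f z (delta_mx 0 j)) ->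
  (forall j, {for phi x, continuous (pd j f)}) ->
  is_derive x v (fun y => f (phi y)) (\sum_j dphi j * pd j f (phi x)).
Proof.
move=> hphi df cf.
have [fd dfE] := differentiable_pd df cf.
have dp : derivable phi x v.
  by apply/derivable_mxP => i j; rewrite ord1; case: (hphi j).
pose c (h : R) := phi (h *: v + x).
have c0 : c 0 = phi x by rewrite /c scale0r add0r.
have dc1 : derivable c 0 1 by exact: (derivable1P _ _ _).1 dp.
have dc : differentiable c 0 by exact: (derivable1_diffP _ _).1 dc1.
have DcE : 'D_1 c 0 = 'D_v phi x by exact: derive1_line.
have fdc : differentiable f (c 0) by rewrite c0.
have dfc := differentiable_comp dc fdc.
split; first exact: (derivable1P _ _ _).2 ((derivable1_diffP _ _).2 dfc).
rewrite -(derive1_line (f \o phi)).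
change ('D_(1 : R) (f \o c) 0 = \sum_j dphi j * pd j f (phi x)).
have dE : 'd c 0 (1 : R) = 'D_v phi x by rewrite -DcE (deriveE _ dc).
rewrite (deriveE _ dfc) (diff_comp dc fdc) /= dE c0 dfE.
rewrite (derive_mx dp); apply: eq_bigr => j _; rewrite mxE.
by have [_ ->] := hphi j.
Qed.

(** * Smooth functions *)

Section Smooth.
Context {R : realType} {n : nat}.
Implicit Types (U : set 'rV[R]_n) (f g : 'rV[R]_n -> R) (x : 'rV[R]_n).

Lemma smooth_continuous U f x : smooth_on U f -> U x -> {for x, continuous f}.
Proof. by move=> /(_ 0%N)[cf _] /cf. Qed.

Lemma smooth_derivable U f x i : smooth_on U f -> U x ->
  derivable f x (delta_mx 0 i).
Proof. by move=> /(_ 1%N)[_ /(_ i)[df _]] /df. Qed.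

Lemma smooth_is_derive U f x i : smooth_on U f -> U x ->
  is_derive x (delta_mx 0 i) f (pd i f x).
Proof. by move=> sf Ux; apply: derivableP; apply: smooth_derivable sf Ux. Qed.

Lemma smooth_pd U f i : smooth_on U f -> smooth_on U (pd i f).
Proof. by move=> sf k; have [_ /(_ i)[]] := sf k.+1. Qed.

Lemma near_open U x (P : 'rV[R]_n -> Prop) : open U -> U x ->
  (forall y, U y -> P y) -> \forall y \near x, P y.
Proof. by move=> oU Ux hP; apply: filterS hP _; apply: open_nbhs_nbhs. Qed.

Lemma smooth_pdC U f x i j : open U -> smooth_on U f -> U x ->
  pd i (pd j f) x = pd j (pd i f) x.
Proof.
move=> oU sf Ux; apply: derive_comm.
- apply: near_open oU Ux _ => y Uy.
  exact: (And4 (smooth_derivable sf Uy) (smooth_derivable sf Uy)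
    (smooth_derivable (smooth_pd j sf) Uy)
    (smooth_derivable (smooth_pd i sf) Uy)).
- exact: smooth_continuous (smooth_pd i (smooth_pd j sf)) Ux.
- exact: smooth_continuous (smooth_pd j (smooth_pd i sf)) Ux.
Qed.

Lemma eq_pd U f g i x : open U -> (forall y, U y -> f y = g y) -> U x ->
  pd i f x = pd i g x.
Proof.
by move=> oU fg Ux; apply: near_eq_derive; apply: near_open oU Ux fg.
Qed.

Lemma eq_derivable U f g v x : open U -> (forall y, U y -> f y = g y) -> U x ->
  derivable f x v -> derivable g x v.
Proof.
by move=> oU fg Ux; apply: near_eq_derivable; apply: near_open oU Ux fg.
Qed.

Lemma eq_continuous U f g x : open U -> (forall y, U y -> f y = g y) -> U x ->
  {for x, continuous f} -> {for x, continuous g}.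
Proof.
move=> oU fg Ux cf; change (g @ x --> g x); rewrite -(fg _ Ux).
have fgx : {near x, f =1 g} by apply: near_open oU Ux fg.
exact: cvg_trans (near_eq_cvg fgx) cf.
Qed.

(** Derivatives at a point of an open set depend only on nearby values, so a derivative may be
    replaced by any formula that agrees with it on [U]. *)
Lemma Ck_ext k U f g : open U -> (forall x, U x -> f x = g x) ->
  Ck k U f -> Ck k U g.
Proof.
move=> oU; elim: k f g => [|k IH] f g fg [cf df].
  by split=> // x Ux; apply: eq_continuous oU fg Ux (cf _ Ux).
split=> [x Ux|]; first exact: eq_continuous oU fg Ux (cf _ Ux).
move=> i; have [dfi ckf] := df i; split=> [x Ux|].
  exact: eq_derivable oU fg Ux (dfi _ Ux).
by apply: IH ckf => x Ux; exact: eq_pd oU fg Ux.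
Qed.

Lemma smooth_ext U f g : open U -> (forall x, U x -> f x = g x) ->
  smooth_on U f -> smooth_on U g.
Proof. by move=> oU fg sf k; apply: Ck_ext oU fg (sf k). Qed.

Lemma smooth_cst U (a : R) : open U -> smooth_on U (fun=> a).
Proof.
move=> oU k; elim: k a => [|k IH] a; split=> //;
  try by move=> x _; exact: cst_continuous.
move=> i; split=> [x _|]; first exact: derivable_cst.
apply: Ck_ext oU _ (IH 0) => x _.
by rewrite /pd [RHS](derive_cst a).
Qed.

Lemma smoothD U f g : open U -> smooth_on U f -> smooth_on U g ->
  smooth_on U (fun x => f x + g x).
Proof.
move=> oU sf sg k; elim: k f g sf sg => [|k IH] f g sf sg; split=> //.
- by move=> x Ux; apply: continuousD;
    [exact: smooth_continuous sf Ux|exact: smooth_continuous sg Ux].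
- by move=> x Ux; apply: continuousD;
    [exact: smooth_continuous sf Ux|exact: smooth_continuous sg Ux].
move=> i; split=> [x Ux|].
  by apply: derivableD;
    [exact: smooth_derivable sf Ux|exact: smooth_derivable sg Ux].
apply: Ck_ext oU _ (IH _ _ (smooth_pd i sf) (smooth_pd i sg)) => x Ux.
by rewrite /pd [RHS]deriveD //;
    [exact: smooth_derivable sf Ux|exact: smooth_derivable sg Ux].
Qed.

Lemma smoothZ U (a : R) f : open U -> smooth_on U f ->
  smooth_on U (fun x => a * f x).
Proof.
move=> oU sf k; elim: k f sf => [|k IH] f sf; split=> //.
- move=> x Ux; apply: continuousM; first exact: cst_continuous.
  exact: smooth_continuous sf Ux.
- move=> x Ux; apply: continuousM; first exact: cst_continuous.
  exact: smooth_continuous sf Ux.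
move=> i; split=> [x Ux|].
  by apply: derivableZ; exact: smooth_derivable sf Ux.
apply: Ck_ext oU _ (IH _ (smooth_pd i sf)) => x Ux.
by rewrite /pd [RHS]deriveZ //; exact: smooth_derivable sf Ux.
Qed.

Lemma smooth_sum (I : finType) U (F : I -> 'rV[R]_n -> R) : open U ->
  (forall i, smooth_on U (F i)) -> smooth_on U (fun x => \sum_i F i x).
Proof.
move=> oU sF.
suff h (r : seq I) : smooth_on U (fun x => \sum_(i <- r) F i x) by exact: h.
elim: r => [|i r IH].
  by apply: smooth_ext oU _ (smooth_cst 0 oU) => x _; rewrite big_nil.
apply: smooth_ext oU _ (smoothD oU (sF i) IH) => x _.
by rewrite big_cons.
Qed.

End Smooth.

(** * Derivatives of determinants and inverse matrices *)

Section Derivable.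
Context {R : realType} {V : normedModType R}.
Implicit Types (x v : V).

Lemma derivable_sumr (I : finType) (F : I -> V -> R) x v :
  (forall i, derivable (F i) x v) -> derivable (fun y => \sum_i F i y) x v.
Proof.
move=> dF.
have [] := is_derive_sumr (fun i => @derivableP _ _ _ _ _ _ (dF i)).
by [].
Qed.

Lemma derivable_det k (A : V -> 'M[R]_k) x v :
  (forall i j, derivable (fun y => A y i j) x v) ->
  derivable (fun y => \det (A y)) x v.
Proof.
move=> dA; apply: derivable_sumr => s.
apply: derivableZ.
have [dP _] := is_derive_prodr (fun i => @derivableP _ _ _ _ _ _ (dA i (s i))).
exact: dP.
Qed.

(** By the adjugate formula an entry of the inverse is a cofactor divided by the determinant. As
    [invmx] is the identity on singular matrices, invertibility is required on a neighbourhood of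
    [x]. *)
Lemma derivable_invmx k (A : V -> 'M[R]_k) x v i j :
  (\forall y \near x, A y \in unitmx) ->
  (forall i j, derivable (fun y => A y i j) x v) ->
  derivable (fun y => invmx (A y) i j) x v.
Proof.
move=> uA dA.
have det0 : \det (A x) != 0 by have := nbhs_singleton uA; rewrite unitmxE unitfE.
apply: (@near_eq_derivable _ _ _ (fun y => (\det (A y))^-1 * cofactor (A y) j i)).
  by apply: filterS uA => y uy; rewrite /invmx uy !mxE.
apply: (@derivableM _ _ (fun y => (\det (A y))^-1)).
  by apply: derivableV => //; exact: derivable_det.
apply: derivableZ; apply: derivable_det => i' j'.
have -> : (fun y => row' j (col' i (A y)) i' j') =
    (fun y => A y (lift j i') (lift i j')) by apply/funext => y; rewrite !mxE.
exact: dA.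
Qed.

End Derivable.

(** * The Ricci identity *)

Section Chart.
Context {R : realType} {n : nat}.
Variables (U : set 'rV[R]_n) (g : lfield R n 2).
Hypothesis oU : open U.
Hypothesis sg : forall b, smooth_on U (fun x => g x b).
Hypothesis symg : forall x, U x ->
  forall a b, g x [tuple a; b] = g x [tuple b; a].
Hypothesis ug : forall x, U x -> gram g x \in unitmx.

Local Notation Gam := (christoffel g).
Local Notation e_ i := (delta_mx 0 i : 'rV[R]_n).

Lemma covd_cons k (T : lfield R n k) x a (b : k.-tuple 'I_n) :
  covd g T x [tuple of a :: b] = pd a (T^~ b) x -
    \sum_(i < k) \sum_(d < n) Gam d a (tnth b i) x * T x (tset b i d).
Proof. by rewrite /covd (behead_cons_tuple (erefl [tuple of a :: b])). Qed.

(** The connection is torsion free. Symmetry of [g] on the open set [U] passes to the partial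
    derivatives of [g]. *)
Lemma christoffelC d a b x : U x -> Gam d a b x = Gam d b a x.
Proof.
move=> Ux; rewrite /christoffel; congr (_ * _); apply: eq_bigr => e _.
congr (_ * _).
have sym c u v : pd c (g^~ [tuple u; v]) x = pd c (g^~ [tuple v; u]) x.
  by apply: eq_pd oU _ Ux => y Uy; exact: symg.
by rewrite (sym a e b) (sym b a e) (sym e a b) [X in X - _]addrC.
Qed.

Lemma christoffel_is_derive d a b x i : U x ->
  is_derive x (e_ i) (Gam d a b) (pd i (Gam d a b) x).
Proof.
move=> Ux; apply: derivableP; apply: derivableZ; apply: derivable_sumr => e.
apply: (@derivableM _ _ (fun y => invmx (gram g y) d e)).
  apply: derivable_invmx => [|u v]; first exact: near_open oU Ux ug.
  have -> : (fun y => gram g y u v) = g^~ [tuple u; v].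
    by apply/funext => y; rewrite mxE.
  exact: smooth_derivable (sg _) Ux.
apply: derivableB; first apply: derivableD.
- exact: smooth_derivable (smooth_pd a (sg _)) Ux.
- exact: smooth_derivable (smooth_pd b (sg _)) Ux.
- exact: smooth_derivable (smooth_pd e (sg _)) Ux.
Qed.

Section Commutator.
Variables (k : nat) (T : lfield R n k).
Hypothesis sT : forall b, smooth_on U (fun x => T x b).

Lemma pd_covd a b (c : k.-tuple 'I_n) x : U x ->
  pd a ((covd g T)^~ [tuple of b :: c]) x =
  pd a (pd b (T^~ c)) x -
  (\sum_(i < k) \sum_(d < n) pd a (Gam d b (tnth c i)) x * T x (tset c i d) +
   \sum_(i < k) \sum_(d < n) Gam d b (tnth c i) x * pd a (T^~ (tset c i d)) x).
Proof.
move=> Ux.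
have -> : (covd g T)^~ [tuple of b :: c] = fun y => pd b (T^~ c) y -
    \sum_(i < k) \sum_(d < n) Gam d b (tnth c i) y * T y (tset c i d).
  by apply/funext => y; rewrite covd_cons.
have dP := smooth_is_derive a (smooth_pd b (sT c)) Ux.
have dM i d := is_deriveM (christoffel_is_derive d b (tnth c i) a Ux)
  (smooth_is_derive a (sT (tset c i d)) Ux).
have dS := is_derive_sumr (fun i => is_derive_sumr (fun d => dM i d)).
rewrite /pd; have [_ ->] := is_deriveB dP dS.
congr (_ - _); rewrite -big_split; apply: eq_bigr => i _ /=.
rewrite -big_split; apply: eq_bigr => d _ /=.
by rewrite addrC; congr (_ + _); exact: mulrC.
Qed.

(** The classical expression of [R_abc^f] through Christoffel symbols, with the sign convention of
    [riemann_up]. *)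
Definition curvature (a b c f : 'I_n) (x : 'rV[R]_n) : R :=
  pd b (Gam f a c) x - pd a (Gam f b c) x +
  \sum_(d < n) (Gam d a c x * Gam f b d x - Gam d b c x * Gam f a d x).

Lemma covd_covd a b (c : k.-tuple 'I_n) x : U x ->
  covd g (covd g T) x [tuple of a :: [tuple of b :: c]] =
  pd a (pd b (T^~ c)) x
  - \sum_(i < k) \sum_(d < n) pd a (Gam d b (tnth c i)) x * T x (tset c i d)
  - \sum_(i < k) \sum_(d < n) Gam d b (tnth c i) x * pd a (T^~ (tset c i d)) x
  - \sum_(d < n) Gam d a b x * covd g T x [tuple of d :: c]
  - \sum_(i < k) \sum_(d < n) Gam d a (tnth c i) x * pd b (T^~ (tset c i d)) x
  + \sum_(i < k) \sum_(d < n) Gam d a (tnth c i) x *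
      \sum_(j < k) \sum_(e < n) Gam e b (tnth (tset c i d) j) x *
        T x (tset (tset c i d) j e).
Proof.
have regroup (P X Y Z Y' Q : R) :
  P - (X + Y) - (Z + (Y' - Q)) = P - X - Y - Z - Y' + Q by ring.
move=> Ux; rewrite covd_cons pd_covd //.
(* The correction for slot 0 concerns the inner differentiation index [b] and gives the term in
   [Gam d a b]; the slots of [c] give the others. *)
set S := \sum_(i < k.+1) _.
have -> : S = \sum_(d < n) Gam d a b x * covd g T x [tuple of d :: c] +
   (\sum_(i < k) \sum_(d < n) Gam d a (tnth c i) x * pd b (T^~ (tset c i d)) x -
    \sum_(i < k) \sum_(d < n) Gam d a (tnth c i) x *
      \sum_(j < k) \sum_(e < n) Gam e b (tnth (tset c i d) j) x *
        T x (tset (tset c i d) j e)).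
  rewrite /S big_ord_recl; congr (_ + _).
    by apply: eq_bigr => d _; rewrite tset_cons0.
  rewrite -sumrB; apply: eq_bigr => i _; rewrite -sumrB; apply: eq_bigr => d _.
  by rewrite tnth_consS tset_consS covd_cons mulrBr.
exact: regroup.
Qed.

(** Separates the case where both Christoffel symbols act on one slot, which contributes to the
    curvature, from the case of two distinct slots, which is symmetric in [a] and [b]. *)
Lemma quadratic_split a b (c : k.-tuple 'I_n) x :
  \sum_(i < k) \sum_(d < n) Gam d a (tnth c i) x *
      \sum_(j < k) \sum_(e < n) Gam e b (tnth (tset c i d) j) x *
        T x (tset (tset c i d) j e) =
  \sum_(i < k) \sum_(f < n) (\sum_(d < n) Gam d a (tnth c i) x * Gam f b d x) *
      T x (tset c i f) +
  \sum_(i < k) \sum_(j < k | j != i) \sum_(d < n) \sum_(e < n)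
    Gam d a (tnth c i) x * Gam e b (tnth c j) x * T x (tset (tset c i d) j e).
Proof.
rewrite -big_split; apply: eq_bigr => i _ /=.
under eq_bigr do rewrite (bigD1 i) //= mulrDr.
rewrite big_split; congr (_ + _).
  under [RHS]eq_bigr do rewrite mulr_suml.
  rewrite [RHS]exchange_big; apply: eq_bigr => d _.
  rewrite mulr_sumr; apply: eq_bigr => f _ /=.
  by rewrite tnth_tset eqxx tset_tset mulrA.
rewrite exchange_big; apply: eq_bigr => d _.
rewrite mulr_sumr; apply: eq_bigr => j ji.
rewrite mulr_sumr; apply: eq_bigr => e _ /=.
by rewrite tnth_tset (negPf ji) mulrA.
Qed.

(** The pairs [(i, d)] and [(j, e)] exchange roles; substitutions at distinct slots commute. *)
Lemma quadratic_sym a b (c : k.-tuple 'I_n) x :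
  \sum_(i < k) \sum_(j < k | j != i) \sum_(d < n) \sum_(e < n)
    Gam d a (tnth c i) x * Gam e b (tnth c j) x * T x (tset (tset c i d) j e) =
  \sum_(i < k) \sum_(j < k | j != i) \sum_(d < n) \sum_(e < n)
    Gam d b (tnth c i) x * Gam e a (tnth c j) x * T x (tset (tset c i d) j e).
Proof.
rewrite (exchange_big_dep xpredT) //=; apply: eq_bigr => j _.
apply: eq_big => [i|i]; rewrite eq_sym // => ij.
rewrite exchange_big; apply: eq_bigr => e _; apply: eq_bigr => d _ /=.
have -> : tset (tset c i d) j e = tset (tset c j e) i d by exact: tset_tsetC.
by rewrite [X in X * _]mulrC.
Qed.

(** Under exchange of [a] and [b] the second derivatives of [T] agree by Schwarz, the [Gam d a b]
    terms by absence of torsion, the mixed terms cancel in pairs, and the quadratic terms at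
    distinct slots are symmetric. The rest is curvature. *)
Lemma ricci_identity a b (c : k.-tuple 'I_n) x : U x ->
  covd g (covd g T) x [tuple of a :: [tuple of b :: c]] -
  covd g (covd g T) x [tuple of b :: [tuple of a :: c]] =
  \sum_(i < k) \sum_(f < n) curvature a b (tnth c i) f x * T x (tset c i f).
Proof.
(* [P] holds the second derivatives of [T], [X] the derivatives of Christoffel symbols, [Y] and [Y']
   the mixed terms, [Z] the torsion-sensitive term, [Q] and [S] the quadratic terms at equal and at
   distinct slots. *)
have cancel (P X X' Y Y' Z Q Q' S : R) :
    P - X - Y - Z - Y' + (Q + S) - (P - X' - Y' - Z - Y + (Q' + S)) =
    X' - X + Q - Q' by ring.
have expand (u v w z t : R) :
  (u - v + (w - z)) * t = u * t - v * t + w * t - z * t by ring.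
move=> Ux; rewrite !covd_covd // (smooth_pdC a b oU (sT c) Ux).
under [X in _ - (_ - X - _ + _)]eq_bigr do rewrite christoffelC //.
rewrite !quadratic_split quadratic_sym.
have -> : \sum_(i < k) \sum_(f < n)
    curvature a b (tnth c i) f x * T x (tset c i f) =
  \sum_(i < k) \sum_(f < n) pd b (Gam f a (tnth c i)) x * T x (tset c i f) -
  \sum_(i < k) \sum_(f < n) pd a (Gam f b (tnth c i)) x * T x (tset c i f) +
  \sum_(i < k) \sum_(f < n) (\sum_(d < n) Gam d a (tnth c i) x * Gam f b d x) *
      T x (tset c i f) -
  \sum_(i < k) \sum_(f < n) (\sum_(d < n) Gam d b (tnth c i) x * Gam f a d x) *
      T x (tset c i f).
  rewrite -!sumrB -big_split -sumrB; apply: eq_bigr => i _ /=.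
  rewrite -!sumrB -big_split -sumrB; apply: eq_bigr => f _ /=.
  rewrite /curvature sumrB; exact: expand.
exact: cancel.
Qed.

End Commutator.

(** The Ricci identity for the covector [dx^f]: its components are constant, and only the summand
    with upper index [f] survives. *)
Lemma riemann_upE a b c f x : U x -> riemann_up g a b c f x = curvature a b c f x.
Proof.
move=> Ux.
have sd t : smooth_on U (fun y : 'rV[R]_n => dcoord f y t).
  exact: smooth_cst.
have e u v : [tuple u; v; c] = [tuple of u :: [tuple of v :: [tuple c]]].
  exact/val_inj.
rewrite /riemann_up !e ricci_identity // big_ord1 (bigD1 f) //= big1 => [|h hf].
  by rewrite /dcoord /thead tnth_tset_id (eqxx f) mulr1 addr0.
by rewrite /dcoord /thead tnth_tset_id (negPf hf) mulr0.
Qed.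

(** Raises the last index of the constant curvature condition, with Kronecker deltas in place of two
    metric factors. *)
Lemma constant_curvatureE (lam : R) x : U x ->
  (forall a b c d, riemann g a b c d x =
    lam * (g x [tuple a; c] * g x [tuple b; d] -
           g x [tuple a; d] * g x [tuple b; c])) ->
  forall a b c f, curvature a b c f x =
    lam * (g x [tuple a; c] * (b == f)%:R - (a == f)%:R * g x [tuple b; c]).
Proof.
move=> Ux hR a b c f.
(* The discrepancy as a row vector in [f]. Lowering the index multiplies it by the Gram matrix,
   which is invertible, and the product is zero by hypothesis. *)
pose v : 'rV[R]_n := \row_f (curvature a b c f x -
    lam * (g x [tuple a; c] * (b == f)%:R - (a == f)%:R * g x [tuple b; c])).
suff v0 : v = 0 by have /rowP/(_ f) := v0; rewrite !mxE => /subr0_eq.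
have vg : v *m gram g x = 0.
  apply/rowP => d; rewrite !mxE.
  under eq_bigr do rewrite !mxE mulrBl.
  have delta (u : 'I_n) : \sum_(h < n) (u == h)%:R * g x [tuple h; d] =
      g x [tuple u; d].
    rewrite (bigD1 u) //= eqxx mul1r big1 ?addr0 // => h hu.
    by rewrite eq_sym (negPf hu) mul0r.
  rewrite sumrB.
  have := hR a b c d; rewrite /riemann; under eq_bigr do rewrite riemann_upE //.
  move=> ->; apply/eqP; rewrite subr_eq0; apply/eqP.
  rewrite -(delta a) -(delta b) mulr_sumr mulr_suml -sumrB mulr_sumr.
  by apply: eq_bigr => h _; ring.
by rewrite -[v](mulmxK (ug Ux)) vg mul0mx.
Qed.

End Chart.

(** * Killing-Yano tensors in a chart *)

(* Not a tensor by itself: only its antisymmetrization is independent of the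
   chart. *)
Definition partial_field (R : realType) (n k : nat) (T : lfield R n k) :
    lfield R n k.+1 :=
  fun x t => pd (thead t) (T^~ [tuple of behead t]) x.

Lemma partial_field_cons (R : realType) (n k : nat) (T : lfield R n k) x a
    (b : k.-tuple 'I_n) :
  partial_field T x [tuple of a :: b] = pd a (T^~ b) x.
Proof. by rewrite /partial_field (behead_cons_tuple (erefl [tuple of a :: b])). Qed.

Section KillingYanoChart.
Context {R : realType} {n : nat}.
Variables (U : set 'rV[R]_n) (g : lfield R n 2).
Hypothesis oU : open U.
Hypothesis symg : forall x, U x ->
  forall a b, g x [tuple a; b] = g x [tuple b; a].

(** The Christoffel correction runs over all slots of [T], so permuting the indices merely reorders
    its summands. *)
Lemma covd_skewsym k (T : lfield R n k) :
  (forall b, smooth_on U (fun x => T x b)) ->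
  (forall x, U x -> skewsym (T x)) ->
  forall x, U x -> forall a,
    skewsym (fun b : k.-tuple 'I_n => covd g T x [tuple of a :: b]).
Proof.
move=> sT altT x Ux a s b; rewrite !covd_cons mulrBr; congr (_ - _).
  rewrite (@eq_pd _ _ U _ (fun y => (-1) ^+ s * T y b)) //; last first.
    by move=> y Uy; rewrite altT.
  by rewrite /pd; apply: deriveZ; exact: smooth_derivable (sT b) Ux.
rewrite mulr_sumr [RHS](reindex_inj (@perm_inj _ s)); apply: eq_bigr => i _.
rewrite mulr_sumr; apply: eq_bigr => d _.
by rewrite tnth_tpermute tset_tpermute altT // mulrCA.
Qed.

Lemma killing_yano_skewsym k (T : lfield R n k.+1) :
  (forall b, smooth_on U (fun x => T x b)) ->
  (forall x, U x -> skewsym (T x)) ->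
  (forall x, U x -> forall a (b : k.+1.-tuple 'I_n),
     covd g T x [tuple of a :: b] +
     covd g T x [tuple of tnth b ord0 :: tset b ord0 a] = 0) ->
  forall x, U x -> skewsym (covd g T x).
Proof.
move=> sT altT ky x Ux; apply: skewsym_tperm => i t.
case/tupleP: t => a b; rewrite tpermute_swap.
(* Skewness in [b] brings [tnth b i] to the front, where the Killing-Yano equation applies; the sign
   of [s] is common to both terms and drops out. *)
pose s := tperm ord0 i.
have := ky x Ux a (tpermute s b).
rewrite tnth_tpermute tset_tpermute tpermL.
rewrite (covd_skewsym sT altT Ux a s b).
rewrite (covd_skewsym sT altT Ux (tnth b i) s (tset b i a)).
rewrite -mulrDr => /eqP; rewrite mulf_eq0 signr_eq0 /= addrC addr_eq0.
by move/eqP.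
Qed.

(** The right-hand side involves only partial derivatives of [T]; smoothness and the transformation
    law of the covariant derivative are obtained from it. *)
Lemma covd_antisym k (T : lfield R n k) x : U x -> skewsym (covd g T x) ->
  forall t, covd g T x t = antisym (partial_field T x) t.
Proof.
move=> Ux alt t; rewrite -(antisym_id t alt).
(* [G i] is invariant under exchanging the slots 0 and i + 1, the Christoffel
   symbol being symmetric in them. *)
pose G (i : 'I_k) (t : k.+1.-tuple 'I_n) := \sum_(d < n)
  christoffel g d (thead t) (tnth [tuple of behead t] i) x *
  T x (tset [tuple of behead t] i d).
have -> : covd g T x = fun t => partial_field T x t - \sum_i G i t by [].
rewrite antisymB antisym_sum big1 ?subr0 // => i _.
apply: (@antisym_tperm_eq0 _ _ _ _ ord0 (lift ord0 i)) => // u.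
case/tupleP: u => a b; rewrite tpermute_swap /G.
rewrite (behead_cons_tuple (erefl [tuple of a :: b])).
rewrite (behead_cons_tuple (erefl [tuple of tnth b i :: tset b i a])).
apply: eq_bigr => d _; rewrite tnth_tset_id tset_tset !thead_cons.
by rewrite (christoffelC oU symg).
Qed.

Hypothesis sg : forall b, smooth_on U (fun x => g x b).
Hypothesis ug : forall x, U x -> gram g x \in unitmx.

Lemma killing_yano_covd2 k (T : lfield R n k.+1) (lam : R) x :
  (forall b, smooth_on U (fun x => T x b)) ->
  (forall x, U x -> skewsym (T x)) ->
  (forall x, U x -> skewsym (covd g T x)) ->
  U x ->
  (forall a b c d, riemann g a b c d x =
    lam * (g x [tuple a; c] * g x [tuple b; d] -
           g x [tuple a; d] * g x [tuple b; c])) ->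
  forall a (b : k.+2.-tuple 'I_n), covd g (covd g T) x [tuple of a :: b] =
    2 * antisym (fun d : k.+2.-tuple 'I_n => g x [tuple a; thead d] *
      (- (lam / 2) * k.+2%:R * T x [tuple of behead d])) b.
Proof.
move=> sT altT altH Ux hR.
pose F a (d : k.+2.-tuple 'I_n) :=
  g x [tuple a; thead d] * T x [tuple of behead d].
have Fcons a b0 (b : k.+1.-tuple 'I_n) :
    F a [tuple of b0 :: b] = g x [tuple a; b0] * T x b.
  by rewrite /F (behead_cons_tuple (erefl [tuple of b0 :: b])).
(* The expected value of the second derivative: [2 * (- (lam / 2)) * k.+2 = - lam * k.+2]. The
   factor [k.+2] stays next to [antisym], where [antisym_cons] absorbs it. *)
pose S a (b : k.+2.-tuple 'I_n) := - lam * (k.+2%:R * antisym (F a) b).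
have SE a b0 (b : k.+1.-tuple 'I_n) : S a [tuple of b0 :: b] =
    - lam * (g x [tuple a; b0] * T x b -
      \sum_(i < k.+1) g x [tuple a; tnth b i] * T x (tset b i b0)).
  rewrite /S antisym_cons => [|r r0 t].
    congr (_ * (_ - _)); first exact: Fcons.
    by apply: eq_bigr => i _; rewrite tpermute_swap Fcons.
  have [r' ->] := perm_fix0 r0; case/tupleP: t => c t.
  by rewrite tpermute_lift !Fcons altT // odd_lift_perm mulrCA.
suff E a (b : k.+2.-tuple 'I_n) :
    covd g (covd g T) x [tuple of a :: b] - S a b = 0.
  move=> a b; rewrite (subr0_eq (E a b)) /S.
  have cF d : g x [tuple a; thead d] *
      (- (lam / 2) * k.+2%:R * T x [tuple of behead d]) =
      - (lam / 2) * k.+2%:R * F a d by exact: mulrCA.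
  by rewrite (eq_antisym b cF) antisymZ; field.
pose D a (b : k.+2.-tuple 'I_n) :=
  covd g (covd g T) x [tuple of a :: b] - S a b.
rewrite -[LHS]/(D a b); move: a b; apply: skewsym_symmetric_eq0 => a.
  (* Smoothness of the first covariant derivative lets [covd_skewsym] be applied to it, giving
     skewness of the second derivative in its last [k.+2] indices. *)
  have sH c : smooth_on U (fun y => covd g T y c).
    apply: smooth_ext oU (fun y Uy => esym (covd_antisym Uy (altH y Uy) c)) _.
    apply: smoothZ oU _; apply: smooth_sum oU _ => s; apply: smoothZ oU _.
    exact: smooth_pd (sT _).
  move=> s b; rewrite /D [RHS]mulrBr.
  have -> := covd_skewsym sH altH Ux a s b.
  apply: (congr1 (fun z => _ - z)).
  by rewrite /S antisym_skewsym [RHS]mulrCA; congr (_ * _); exact: mulrCA.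
(* Symmetry of [D] in [a] and [b0]: the commutator given by the Ricci identity must equal [S a]
   minus [S b0] with [a] and [b0] exchanged. In that difference the terms with [g x [tuple a; b0]]
   cancel because [g] is symmetric. *)
move=> b; case/tupleP: b => b0 b; rewrite /D tset_cons0 tnth_cons0.
have := ricci_identity oU sg symg ug sT a b0 b Ux.
under eq_bigr do under eq_bigr do
  rewrite (constant_curvatureE oU sg symg ug Ux hR).
have sumE (i : 'I_k.+1) : \sum_(f < n) lam *
    (g x [tuple a; tnth b i] * (b0 == f)%:R -
     (a == f)%:R * g x [tuple b0; tnth b i])
      * T x (tset b i f) =
    lam * (g x [tuple a; tnth b i] * T x (tset b i b0) -
           g x [tuple b0; tnth b i] * T x (tset b i a)).
  have delta (h : 'I_n -> R) u : \sum_(f < n) (u == f)%:R * h f = h u.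
    rewrite (bigD1 u) //= eqxx mul1r big1 ?addr0 // => f fu.
    by rewrite eq_sym (negPf fu) mul0r.
  rewrite -(delta (fun f => T x (tset b i f)) b0).
  rewrite -(delta (fun f => T x (tset b i f)) a).
  rewrite !mulr_sumr -sumrB mulr_sumr; apply: eq_bigr => f _; ring.
under eq_bigr do rewrite sumE.
rewrite -mulr_sumr sumrB => ricci.
rewrite !SE (symg Ux b0 a); apply/eqP; rewrite -subr_eq0.
set P := covd _ _ _ _ in ricci *; set Q := covd _ _ _ _ in ricci *.
set X := \sum_(i < k.+1) _ in ricci *; set Y := \sum_(i < k.+1) _ in ricci *.
have -> : P = lam * (X - Y) + Q by rewrite -ricci subrK.
apply/eqP; ring.
Qed.

End KillingYanoChart.

(** * Change of coordinates for the antisymmetrized partial derivative *)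

Lemma big_cons_tuple (R : realType) (n k : nat) (F : k.+1.-tuple 'I_n -> R) :
  \sum_(t : k.+1.-tuple 'I_n) F t =
  \sum_(a < n) \sum_(b : k.-tuple 'I_n) F [tuple of a :: b].
Proof.
rewrite pair_big.
rewrite (reindex (fun ab : 'I_n * k.-tuple 'I_n => [tuple of ab.1 :: ab.2])) //=.
exists (fun t => (thead t, [tuple of behead t])) => [[a b]|t] _ /=.
  by congr pair; apply/val_inj.
by rewrite -tuple_eta.
Qed.

Section Transition.
Context {R : realType} {n : nat}.
Variables (U V : set 'rV[R]_n) (phi : 'rV[R]_n -> 'rV[R]_n).
Hypotheses (oU : open U) (oV : open V).
Hypothesis phiU : forall x, U x -> V (phi x).
Hypothesis sphi : forall j, smooth_on U (fun x => phi x 0 j).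
Variables (k : nat) (T T' : lfield R n k).
Hypothesis sT' : forall b, smooth_on V (fun x => T' x b).

Local Notation J := (fun j i x => pd i (fun y => phi y 0 j) x).

Hypothesis TT' : forall x, U x -> forall b,
  T x b = \sum_(d : k.-tuple 'I_n)
    (\prod_(i < k) J (tnth d i) (tnth b i) x) * T' (phi x) d.

(** Differentiating the transformation law gives the tensorial term [W], with one more Jacobian
    factor from the chain rule, and the terms [E i]. Antisymmetrization annihilates each [E i] and
    commutes with the coordinate change in [W]. *)
Lemma antisym_partial_transition x : U x -> forall t,
  antisym (partial_field T x) t =
  \sum_(d : k.+1.-tuple 'I_n) (\prod_(i < k.+1) J (tnth d i) (tnth t i) x) *
    antisym (partial_field T' (phi x)) d.
Proof.
move=> Ux t.
pose W t := \sum_(d : k.+1.-tuple 'I_n)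
  (\prod_(i < k.+1) J (tnth d i) (tnth t i) x) * partial_field T' (phi x) d.
(* [E i] carries the second derivatives of [phi]; by their symmetry it is
   invariant under exchanging the slots 0 and i + 1. *)
pose E (i : 'I_k) (t : k.+1.-tuple 'I_n) := \sum_(d : k.-tuple 'I_n)
  pd (tnth t ord0) (J (tnth d i) (tnth t (lift ord0 i))) x *
  (\prod_(j | j != i) J (tnth d j) (tnth t (lift ord0 j)) x) * T' (phi x) d.
have WE u : partial_field T x u = W u + \sum_i E i u.
  case/tupleP: u => a b; rewrite partial_field_cons.
  rewrite (eq_pd a oU (fun y Uy => TT' Uy b) Ux).
  have dJ (d : k.-tuple 'I_n) i := smooth_is_derive a
    (smooth_pd (tnth b i) (sphi (tnth d i))) Ux.
  have dT d : is_derive x (delta_mx 0 a) (fun y => T' (phi y) d)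
      (\sum_j J j a x * pd j (T'^~ d) (phi x)).
    apply: is_derive_comp => [j||j].
    - exact: smooth_is_derive (sphi j) Ux.
    - apply: near_open oV (phiU Ux) _ => z Vz j.
      exact: smooth_derivable (sT' d) Vz.
    - exact: smooth_continuous (smooth_pd j (sT' d)) (phiU Ux).
  have dS := is_derive_sumr (fun d => is_deriveM (is_derive_prodr (dJ d)) (dT d)).
  rewrite {1}/pd; have [_ ->] := dS.
  (* Of the two Leibniz terms, the derivative of [T'] along [phi] gives [W], and the derivative of
     the Jacobian product gives the sum of the [E i]. *)
  rewrite big_split /=; congr (_ + _).
    rewrite /W big_cons_tuple exchange_big; apply: eq_bigr => d _ /=.
    rewrite [_ *: _]mulr_sumr; apply: eq_bigr => e _.
    rewrite partial_field_cons big_ord_recl !tnth_cons0.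
    under [in RHS]eq_bigr do rewrite !tnth_consS.
    by rewrite mulrCA mulrA.
  rewrite /E exchange_big; apply: eq_bigr => d _ /=.
  rewrite [_ *: _]mulr_sumr; apply: eq_bigr => i _.
  rewrite tnth_cons0 tnth_consS [LHS]mulrC.
  apply: (congr1 (fun z => z * _)); apply: (congr1 ( *%R _)).
  by apply: eq_bigr => j _; rewrite tnth_consS.
rewrite (eq_antisym _ WE) antisymD (antisym_sum E) big1 ?addr0 => [|i _].
  exact: (@antisym_change R n k.+1 (fun j i => pd i (fun y => phi y 0 j) x)).
apply: (@antisym_tperm_eq0 R n k.+1 (E i) ord0 (lift ord0 i)) => [|u].
  exact: neq_lift.
rewrite /E !tnth_tpermute tpermL tpermR; apply: eq_bigr => d _.
apply: (congr1 (fun z => z * _)).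
apply: (congr2 *%R); first exact: smooth_pdC oU (sphi _) Ux.
apply: eq_bigr => j ji.
by rewrite tnth_tpermute tpermD // (inj_eq lift_inj) eq_sym.
Qed.

End Transition.

(** * Tensors on the manifold *)

Section Manifold.
Context {R : realType} {n : nat} {M : manifold R n}.

Lemma open_mimg (c : mchart M) : open (mimg c).
Proof. exact: m_img_open. Qed.

(** Continuity of [minv c] sends all points close to [mmap c m] into the open set [mdom c']. *)
Lemma overlap_open (c c' : mchart M) : open (mmap c @` (mdom c `&` mdom c')).
Proof.
rewrite openE => _ [m [mc mc'] <-]; rewrite /interior.
have nc : nbhs (mmap c m) (mimg c).
  by apply: open_nbhs_nbhs; split; [exact: open_mimg|exists m].
have nc' : nbhs (mmap c m) (minv c @^-1` mdom c').
  apply: (m_inv_cont mc); rewrite m_mapK //.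
  by apply: open_nbhs_nbhs; split => //; exact: m_dom_open.
apply: filterS (filterI nc nc') => _ [[m' m'c <-]] /=.
by rewrite m_mapK // => m'c'; exists m'.
Qed.

Lemma tensorZ k (T : tfield M k) (a : R) : is_tensor T ->
  is_tensor (fun c x b => a * T c x b).
Proof.
move=> [sT tT]; split=> [c b|c c' m mc mc' b].
  exact: smoothZ (@open_mimg c) (sT c b).
by rewrite (tT c c' m) // mulr_sumr; apply: eq_bigr => d _; rewrite mulrCA.
Qed.

(** Total skewness identifies the covariant derivative with the antisymmetrized partial derivative
    in every chart, and the latter is smooth and transforms as a tensor. *)
Lemma nabla_tensor (g : tfield M 2) k (T : tfield M k) : is_metric g ->
  is_tensor T ->
  (forall c x, mimg c x -> skewsym (nabla g T c x)) -> is_tensor (nabla g T).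
Proof.
move=> [_ symg _] [sT tT] skH.
have HE c x t (cx : mimg c x) :
    nabla g T c x t = antisym (partial_field (T c) x) t.
  exact: (covd_antisym (@open_mimg c) (symg c) cx (skH c x cx)).
split=> [c t|c c' m mc mc' t].
  have oc := @open_mimg c.
  apply: (smooth_ext oc (fun x cx => esym (HE c x t cx))).
  apply: (smoothZ _ oc); apply: (smooth_sum oc) => s; apply: (smoothZ _ oc).
  exact: smooth_pd (sT c _).
have cm : mimg c (mmap c m) by exists m.
have cm' : mimg c' (mmap c' m) by exists m.
rewrite HE //; under eq_bigr do rewrite HE //.
(* Puts the point [mmap c' m] in the form of the transition map evaluated at [mmap c m]. *)
have E : mmap c' (minv c (mmap c m)) = mmap c' m by rewrite m_mapK.
rewrite -E.
apply: (antisym_partial_transition (@overlap_open c c') (@open_mimg c')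
  _ (m_transition c c') (sT c')).
- by move=> _ [m' [m'c m'c'] <-]; rewrite m_mapK //; exists m'.
- by move=> _ [m' [m'c m'c'] <-] b; rewrite m_mapK //; exact: tT.
- by exists m.
Qed.

End Manifold.

Theorem theorem1 (R : realType) (n : nat) (M : manifold R n) (g : tfield M 2)
  (lambda : R) (p : nat) (A : tfield M p)
  (hg : is_metric g)
  (hmax : maximally_symmetric g)
  (hcurv : constant_curvature g lambda)
  (hlambda : lambda != 0)
  (hp : (2 <= p)%N)
  (hA : killing_yano g A) :
  closed_conformal_killing_yano g (nabla g A) /\
  ccky_equation g (nabla g A)
    (fun c x b => - (lambda / 2) * p.+1%:R * A c x b).
Proof.
(* With [p = k.+1] the first index of [A] sits in slot [ord0], and the factor [p.+1] reads
   [k.+2]. *)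
case: p A hp hA => // k A _ [tA skA ky].
have [[sg _] symg ug] := hg.
have [sA _] := tA.
have skH c x : mimg c x -> skewsym (nabla g A c x).
  apply: (killing_yano_skewsym (@open_mimg _ _ M c) (sA c) (skA c)).
  move=> {}x cx a b.
  exact: ky.
have eqH : ccky_equation g (nabla g A)
    (fun c x b => - (lambda / 2) * k.+2%:R * A c x b).
  move=> c x cx a b.
  exact: (killing_yano_covd2 (@open_mimg _ _ M c) (symg c) (sg c) (ug c)
    (sA c) (skA c) (skH c) cx (hcurv c x cx)).
split=> //; split=> //; first exact: nabla_tensor.
exists (fun c x b => - (lambda / 2) * k.+2%:R * A c x b); split=> //.
  exact: tensorZ.
by move=> c x cx s b; rewrite skA // mulrCA.
Qed.
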